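(* Let $\mathcal{F}=\{f_1,\ldots,f_n\}$ be a system and let $F:\Gamma\to\Gamma$ be the skew-product associated to $\mathcal{F}$, defined on $\Gamma$. Then $$h_{\mathrm{top}}(F)=h_{\mathrm{top}}(\mathcal{F}).$$
   Context: A system is a finite family $\mathcal{F}=\{f_1,\ldots,f_n\}$ of continuous strictly monotone functions $f_i:I_i\to\mathbb{R}$, where each $I_i=\mathrm{Dom}(f_i)$ is a compact interval with more than one point. Compositions are taken with their natural domain (possibly empty). **Entropy of $\mathcal{F}$.** For $m\ge1$ let $\ell(m)$ be the number of sequences $(i_1,\ldots,i_m)\in\{1,\ldots,n\}^m$ such that $\mathrm{int}(\mathrm{Dom}(f_{i_m}\circ\cdots\circ f_{i_1}))\ne\emptyset$. Then $h_{\mathrm{top}}(\mathcal{F})=\limsup_{m\to\infty}\frac1m\log\ell(m)$. **Symbolic space.** Let $\mathcal{A}=\{1,\ldots,n,\varnothing\}$. $\Sigma\subset\mathcal{A}^{\mathbb{N}}$, $\mathbb{N}=\{1,2,\ldots\}$, is the set of sequences $\underline\omega=(\omega_m)_{m\ge1}$ such that either $\omega_m\ne\varnothing$ for all $m$, or there is $k\ge0$ with $\omega_m\neq\varnothing$ for $1\le m\le k$ and $\omega_m=\varnothing$ for all $m>k$. It carries the metric $d(\underline\omega,\underline\upsilon)=\sum_{m\ge1}2^{-m}\delta_{\omega_m,\upsilon_m}$, where $\delta_{\omega_m,\upsilon_m}=1$ if $\omega_m\ne\upsilon_m$ and $0$ otherwise. The left shift $\varrho:\Sigma\to\Sigma$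 is $[\varrho(\underline\omega)]_m=\omega_{m+1}$. **Skew-product.** Put $f_\varnothing=\mathrm{Id}_{\mathbb{R}}$. A sequence $\underline\omega\in\Sigma$ is admissible for $x\in\mathbb{R}$ if for all $m\ge1$, $\mathrm{int}(\mathrm{Dom}(f_{\omega_m}\circ\cdots\circ f_{\omega_1}))\ne\emptyset$ and $x\in\mathrm{Dom}(f_{\omega_m}\circ\cdots\circ f_{\omega_1})$. Let $\widehat I=\bigcup_{i=1}^n(\mathrm{Dom}(f_i)\cup\mathrm{Im}(f_i))$ and $\Gamma=\{(\underline\omega,x)\in\Sigma\times\widehat I:\underline\omega\text{ is admissible for }x\}$, with metric $d_\Gamma((\underline\omega,x),(\underline\upsilon,y))=\max\{d(\underline\omega,\underline\upsilon),|x-y|\}$; $\Gamma$ is compact. The skew-product associated to $\mathcal{F}$ is the continuous map $F:\Gamma\to\Gamma$, $F(\underline\omega,x)=(\varrho(\underline\omega),f_{\omega_1}(x))$, and $h_{\mathrm{top}}(F)$ is its usual (Bowen) topological entropy.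
   Formalization: The convention log 0 = 0 is used in the entropy of the system: if ℓ(m)=0 for all large m (e.g. one map from [0,1] onto [2,3]), log ℓ(m) is undefined or −∞ while h_top(F)=0, so the entropy of the system is taken to be 0 in that case. *)

(* Defs.v *)
From mathcomp Require Import all_boot all_order all_algebra.
From mathcomp Require Import all_classical all_reals all_analysis.
Set Implicit Arguments.
Unset Strict Implicit.
Unset Printing Implicit Defensive.
Import Order.TTheory GRing.Theory Num.Theory.
Import numFieldNormedType.Exports.
Local Open Scope classical_set_scope.
Local Open Scope ring_scope.

(* Each [sys_fun i] is a total function, but only its values on the interval
   [sys_dom S i] (defined below) are ever constrained or used. *)
Record system (R : realType) (n : nat) := System {
  sys_lo : 'I_n -> R;
  sys_hi : 'I_n -> R;
  sys_fun : 'I_n -> R -> R;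
  sys_lt : forall i, sys_lo i < sys_hi i;
  sys_cont : forall i, {within `[sys_lo i, sys_hi i], continuous (sys_fun i)};
  sys_mono : forall i,
    {in `[sys_lo i, sys_hi i] &, {homo sys_fun i : x y / x < y}} \/
    {in `[sys_lo i, sys_hi i] &, {homo sys_fun i : x y /~ x < y}} }.

Definition sys_dom (R : realType) (n : nat) (S : system R n) (i : 'I_n) :
  set R := `[sys_lo S i, sys_hi S i].

(* The alphabet {1, ..., n, empty} is [option 'I_n], with [None] for the empty
   symbol, whose function is the identity of the whole line. *)
Definition letter_dom (R : realType) (n : nat) (S : system R n)
  (s : option 'I_n) : set R := if s is Some i then sys_dom S i else setT.

Definition letter_fun (R : realType) (n : nat) (S : system R n)
  (s : option 'I_n) : R -> R := if s is Some i then sys_fun S i else id.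

(* Natural domain of f_{s_m} o ... o f_{s_1} for the word [:: s_1; ...; s_m]:
   the head of the word is the function applied first. *)
Fixpoint word_dom (R : realType) (n : nat) (S : system R n)
  (w : seq (option 'I_n)) : set R :=
  if w is s :: w' then
    letter_dom S s `&` (letter_fun S s @^-1` word_dom S w')
  else setT.

Definition ell (R : realType) (n : nat) (S : system R n) (m : nat) : nat :=
  #|[set w : m.-tuple 'I_n |
      `[< (word_dom S (map Some w))° !=set0 >]]%SET|.

(* If no word of length m has a domain with nonempty interior, then
   [ell S m = 0] and [ln] returns 0: the convention is log 0 = 0, so that a
   system all of whose long compositions are degenerate has entropy 0. *)
Definition htop_system (R : realType) (n : nat) (S : system R n) : \bar R :=
  limn_esup (fun m : nat => (m%:R^-1 * ln (ell S m)%:R : R)%:E).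

(* Sequences are indexed from 0: [w m] is the (m+1)-st symbol. *)
Definition Sigma (n : nat) : set (nat -> option 'I_n) :=
  [set w | (forall m, w m <> None) \/
           (exists k : nat, (forall m, (m < k)%N -> w m <> None) /\
                            (forall m, (k <= m)%N -> w m = None))].

Definition symb_dist (R : realType) (n : nat) (w v : nat -> option 'I_n) : R :=
  limn (series (fun m : nat => (2^-1) ^+ m.+1 * (w m != v m)%:R : R)).

Definition symb_shift (n : nat) (w : nat -> option 'I_n) : nat -> option 'I_n :=
  fun m => w m.+1.

Definition admissible (R : realType) (n : nat) (S : system R n)
  (w : nat -> option 'I_n) (x : R) : Prop :=
  forall m : nat, (1 <= m)%N ->
    (word_dom S (mkseq w m))° !=set0 /\ word_dom S (mkseq w m) x.

Definition Ihat (R : realType) (n : nat) (S : system R n) : set R :=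
  \bigcup_(i in [set: 'I_n]) (sys_dom S i `|` (sys_fun S i @` sys_dom S i)).

Definition Gamma (R : realType) (n : nat) (S : system R n) :
  set ((nat -> option 'I_n) * R) :=
  [set p | [/\ @Sigma n p.1, Ihat S p.2 & admissible S p.1 p.2]].

Definition Gamma_dist (R : realType) (n : nat) (S : system R n)
  (p q : Gamma S) : R :=
  Num.max (symb_dist R (val p).1 (val q).1) `|(val p).2 - (val q).2|.

Definition skew_fun (R : realType) (n : nat) (S : system R n)
  (p : (nat -> option 'I_n) * R) : (nat -> option 'I_n) * R :=
  (symb_shift p.1, letter_fun S (p.1 0%N) p.2).

Lemma Sigma_symb_shift (n : nat) (w : nat -> option 'I_n) :
  Sigma w -> Sigma (symb_shift w).
Proof.
case=> [wN|[k [wlt wge]]]; first by left=> m; exact: wN.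
right; exists k.-1; split=> m mk.
  by apply: wlt; rewrite -ltn_predRL.
by apply: wge; apply: (leq_trans (leqSpred k)).
Qed.

Lemma interior_sys_fun (R : realType) (n : nat) (S : system R n) (i : 'I_n)
  (B : set R) :
  (sys_dom S i `&` sys_fun S i @^-1` B)° !=set0 -> B° !=set0.
Proof.
case=> x /nbhs_ballP[e /= e0 xe].
pose y := x + e / 2.
have e2 : 0 < e / 2 by rewrite divr_gt0.
have xy : x < y by rewrite ltrDl.
have sub z : z \in `[x, y] -> (sys_dom S i `&` sys_fun S i @^-1` B) z.
  rewrite in_itv/= => /andP[xz zy]; apply: xe.
  rewrite /ball/= ler0_norm ?subr_le0// opprB ltrBlDl.
  by rewrite (le_lt_trans zy)// ltrD2l ltr_pdivrMr// ltr_pMr// ltr1n.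
have xI : x \in `[x, y] by rewrite in_itv/= lexx ltW.
have yI : y \in `[x, y] by rewrite in_itv/= lexx ltW.
have fc : {within `[x, y], continuous (sys_fun S i)}.
  apply: continuous_subspaceW (@sys_cont _ _ S i) => z /= zI.
  by have [] := sub z zI.
have BI v : Num.min (sys_fun S i x) (sys_fun S i y) <= v
    <= Num.max (sys_fun S i x) (sys_fun S i y) -> B v.
  by move=> /(IVT (ltW xy) fc)[c cI <-]; have [] := sub c cI.
have mM : Num.min (sys_fun S i x) (sys_fun S i y) <
          Num.max (sys_fun S i x) (sys_fun S i y).
  have [xD _] := sub _ xI; have [yD _] := sub _ yI.
  have /orP[fxy|fyx] : (sys_fun S i x < sys_fun S i y) ||
                       (sys_fun S i y < sys_fun S i x).
    by case: (sys_mono S i) => h; [rewrite h|rewrite orbC h].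
  - by rewrite (min_idPl (ltW fxy)) (max_idPr (ltW fxy)).
  - by rewrite (min_idPr (ltW fyx)) (max_idPl (ltW fyx)).
set a := Num.min _ _ in BI mM; set b := Num.max _ _ in BI mM.
exists ((a + b) / 2).
have [am mb] := midf_lt mM.
have : nbhs ((a + b) / 2) `]a, b[%classic.
  by apply: open_nbhs_nbhs; split; [exact: interval_open|rewrite /= in_itv/= am].
apply: filterS => v /=; rewrite in_itv/= => /andP[av vb].
by apply: BI; rewrite !ltW.
Qed.

Lemma Gamma_skew (R : realType) (n : nat) (S : system R n)
  (p : (nat -> option 'I_n) * R) : Gamma S p -> Gamma S (skew_fun S p).
Proof.
case: p => w x [/= Sw Ix adm]; split; first exact: Sigma_symb_shift.
  have [_] := adm 1%N isT; rewrite /=.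
  case: (w 0%N) => [i [xi _]|//].
  by exists i => //; right; exists x.
move=> m m1; have [] := adm m.+1 isT.
rewrite /mkseq/= -[1%N]addn0 iotaDl -map_comp /=.
rewrite -/(mkseq (symb_shift w) m).
move=> int [_ xm]; split=> //.
case: (w 0%N) int {xm} => [i|]; first exact: interior_sys_fun.
by rewrite /= setTI.
Qed.

Definition skew_product (R : realType) (n : nat) (S : system R n)
  (p : Gamma S) : Gamma S :=
  SigSub (mem_set (Gamma_skew (set_mem (valP p)))).

Definition orbit_dist (R : realType) (X : Type) (d : X -> X -> R) (F : X -> X)
  (m : nat) (x y : X) : R :=
  \big[Num.max/0]_(j < m) d (iter j F x) (iter j F y).

Definition orbit_separated (R : realType) (X : Type) (d : X -> X -> R) (F : X -> X)
  (m : nat) (e : R) (E : set X) : Prop :=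
  forall x y, E x -> E y -> x <> y -> e < orbit_dist d F m x y.

Definition sep_card (R : realType) (X : Type) (d : X -> X -> R) (F : X -> X)
  (m : nat) (e : R) : \bar R :=
  ereal_sup [set N%:R%:E | N in
    [set N : nat | exists E : set X, (E #= `I_N)%card /\ orbit_separated d F m e E]].

Definition bowen_entropy (R : realType) (X : Type) (d : X -> X -> R)
  (F : X -> X) : \bar R :=
  lim (limn_esup (fun m : nat => (m%:R^-1)%:E * lne (sep_card d F m e))%E
       @[e --> 0^'+]).

(* Main.v *)
(** Writing a word of [F] followed by empty symbols above a point of its domain
    gives [ell m] orbits whose symbols differ at some time before [m]; they are
    [(m, e)]-separated as soon as [e < 1/2].

    Conversely, fix [r] with [2^-r <= e] and a word of length [m + r].  Over that
    word the iterates [x |-> x_j] are monotone, so with suitable signs depending on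
    the word only, [sum_(j < m) +- x_j] is a nondecreasing function of [x] whose
    increments dominate every [|x_j - y_j|].  It takes values in an interval of
    length [O(m)], hence an [(m, e)]-separated set has [O(m / e)] points over each
    word.  A word of [Sigma] of length [m + r] is a word of [F] of length
    [k <= m + r] followed by empty symbols, so the number of words is at most
    [sum_(k <= m + r) ell k], which has the growth rate of [ell]. *)

Require Import Defs.
From mathcomp Require Import all_boot all_order all_algebra.
From mathcomp Require Import all_classical all_reals all_analysis.
From mathcomp Require Import zify ring lra.
Set Implicit Arguments.
Unset Strict Implicit.
Unset Printing Implicit Defensive.
Import Order.TTheory GRing.Theory Num.Theory.
Import numFieldNormedType.Exports.
Local Open Scope classical_set_scope.
Local Open Scope ring_scope.

(** * The metric on symbol sequences *)

Lemma symb_dist_cvg (R : realType) (n : nat) (w v : nat -> option 'I_n) :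
  cvgn (series (fun m : nat => (2^-1) ^+ m.+1 * (w m != v m)%:R : R)).
Proof.
apply: (@series_le_cvg _ _ (geometric (2^-1) (2^-1))) => [m|m|m|].
- by rewrite mulr_ge0.
- by rewrite /= mulr_ge0.
- by rewrite /= -exprS ler_piMr// lern1 leq_b1.
by apply: is_cvg_geometric_series; rewrite gtr0_norm ?invf_lt1// ltr1n.
Qed.

Lemma symb_dist_head_neq (R : realType) (n : nat) (w v : nat -> option 'I_n) :
  w 0%N != v 0%N -> 2^-1 <= symb_dist R w v.
Proof.
set u := (fun m : nat => (2^-1) ^+ m.+1 * (w m != v m)%:R : R) => wv0.
apply: (@le_trans _ _ (series u 1)).
  by rewrite /series/= big_nat1 /u wv0 mulr1 expr1.
apply: (@nondecreasing_cvgn_le R (series u)) => //; last exact: symb_dist_cvg.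
by apply/nondecreasing_seqP => i; rewrite /series/= big_nat_recr//= lerDl mulr_ge0.
Qed.

Lemma symb_dist_prefix (R : realType) (n r : nat) (w v : nat -> option 'I_n) :
  (forall i, (i < r)%N -> w i = v i) -> symb_dist R w v <= (2^-1) ^+ r.
Proof.
move=> wv; apply: limr_le; first exact: symb_dist_cvg.
apply: nearW => N.
(* The added power is the total weight of the indices from [maxn N r] on; with it the bound passes
   through the induction on [N]. *)
suff : series (fun m : nat => (2^-1) ^+ m.+1 * (w m != v m)%:R : R) N
    + (2^-1) ^+ (maxn N r) <= (2^-1) ^+ r.
  by apply: le_trans; rewrite lerDl.
elim: N => [|N IH]; first by rewrite /series/= big_geq// add0r max0n.
apply: le_trans IH; rewrite /series/= big_nat_recr//= -addrA lerD2l.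
have [rN|Nr] := leqP r N; last first.
  by rewrite wv// eqxx mulr0 add0r (maxn_idPr Nr).
rewrite (maxn_idPl (leqW rN)).
have h : (2^-1 : R) ^+ N.+1 + (2^-1) ^+ N.+1 = (2^-1) ^+ N.
  by rewrite exprS; lra.
by rewrite -h lerD2r ler_piMr// lern1 leq_b1.
Qed.

(** * Iterates of the skew-product and their orientation over a word *)

Lemma val_iter_skew_product (R : realType) (n : nat) (S : system R n) (j : nat)
    (p : Gamma S) :
  val (iter j (@skew_product R n S) p) = iter j (skew_fun S) (val p).
Proof. by elim: j => //= j ->. Qed.

Lemma iter_skew_fun_symb (R : realType) (n : nat) (S : system R n) (j : nat)
    (p : (nat -> option 'I_n) * R) (i : nat) :
  (iter j (skew_fun S) p).1 i = p.1 (i + j)%N.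
Proof. by elim: j i => [|j IH] i /=; rewrite ?addn0// /symb_shift IH addSnnS. Qed.

Lemma Gamma_iter (R : realType) (n : nat) (S : system R n) (j : nat)
    (p : Gamma S) : Gamma S (iter j (skew_fun S) (val p)).
Proof. by rewrite -val_iter_skew_product; exact: (set_mem (valP _)). Qed.

Lemma Gamma_letter_dom (R : realType) (n : nat) (S : system R n)
    (p : (nat -> option 'I_n) * R) :
  Gamma S p -> letter_dom S (p.1 0%N) p.2.
Proof. by case=> _ _ adm; have [_ []] := adm 1%N isT. Qed.

Definition letter_sgn (R : realType) (n : nat) (S : system R n)
    (s : option 'I_n) : R :=
  if s is Some i then
    (-1) ^+ ~~ `[< {in `[sys_lo S i, sys_hi S i] &,
                    {homo sys_fun S i : x y / x < y}} >]
  else 1.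

Lemma letter_sgnP (R : realType) (n : nat) (S : system R n) (s : option 'I_n)
    (x y : R) : letter_dom S s x -> letter_dom S s y -> x <= y ->
  0 <= letter_sgn S s * (letter_fun S s y - letter_fun S s x).
Proof.
case: s => [i|] /=; last by rewrite mul1r subr_ge0.
rewrite /sys_dom /= => xD yD; rewrite le_eqVlt => /predU1P[->|xy].
  by rewrite subrr mulr0.
case: asboolP => h /=; first by rewrite mul1r subr_ge0 ltW// h.
case: (sys_mono S i) => // g.
by rewrite mulN1r opprB subr_ge0 ltW// g.
Qed.

Lemma letter_sgn_norm (R : realType) (n : nat) (S : system R n)
    (s : option 'I_n) : `|letter_sgn S s| = 1.
Proof. by case: s => [i|] /=; rewrite ?normr1// normr_sign. Qed.

(** Orientation of the composition of the first [j] letters; it depends on the word only, so all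
    points over a word share it. *)
Definition word_sgn (R : realType) (n : nat) (S : system R n)
    (w : nat -> option 'I_n) (j : nat) : R := \prod_(l < j) letter_sgn S (w l).

Lemma word_sgn_norm (R : realType) (n : nat) (S : system R n)
    (w : nat -> option 'I_n) (j : nat) : `|word_sgn S w j| = 1.
Proof. by rewrite normr_prod big1// => l _; exact: letter_sgn_norm. Qed.

Lemma word_sgnP (R : realType) (n : nat) (S : system R n) (j : nat)
    (p q : Gamma S) :
  (forall i, (i < j)%N -> (val p).1 i = (val q).1 i) -> (val p).2 <= (val q).2 ->
  0 <= word_sgn S (val p).1 j * ((iter j (skew_fun S) (val q)).2
                                 - (iter j (skew_fun S) (val p)).2).
Proof.
move=> pq pq2; elim: j pq => [|j IH] pq.
  by rewrite /word_sgn big_ord0 mul1r subr_ge0.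
have := IH (fun i ij => pq i (ltnW ij)).
rewrite /word_sgn big_ord_recr/= -!/(word_sgn _ _ _) -mulrA !iter_skew_fun_symb !add0n -pq//.
have pD := Gamma_letter_dom (Gamma_iter j p).
have qD := Gamma_letter_dom (Gamma_iter j q).
rewrite iter_skew_fun_symb add0n in pD.
rewrite iter_skew_fun_symb add0n -pq// in qD.
set x := (iter j _ (val p)).2 in pD *; set y := (iter j _ (val q)).2 in qD *.
(* The sign up to [j] is 1 or -1; by induction it tells how the two [j]-th iterates are ordered,
   hence in which order [letter_sgnP] applies to them. *)
have : `|word_sgn S (val p).1 j| == 1 by rewrite word_sgn_norm.
rewrite -[X in `|_| == X]normr1 eqr_norm2 => /orP[]/eqP-> h.
  by rewrite mul1r letter_sgnP// -subr_ge0 -[_ - _]mul1r.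
rewrite mulN1r -mulrN opprB letter_sgnP// -subr_ge0.
by rewrite -[_ - _]opprB -mulN1r.
Qed.

(** A monotone function maps an interval between its two endpoint values, so the endpoints and
    endpoint values of the finitely many functions give a bound. *)
Lemma Ihat_bounded (R : realType) (n : nat) (S : system R n) :
  exists2 M : R, 0 < M & forall x, Ihat S x -> `|x| <= M.
Proof.
pose b i := `|sys_lo S i| + `|sys_hi S i| + `|sys_fun S i (sys_lo S i)|
            + `|sys_fun S i (sys_hi S i)|.
have b0 i : 0 <= b i by rewrite !addr_ge0.
exists (1 + \sum_i b i); first by rewrite ltr_pwDl// sumr_ge0.
move=> x [i _ xi]; apply: (@le_trans _ _ (b i)); last first.
  rewrite (bigD1 i)//= addrCA lerDl addr_ge0// sumr_ge0//.
have bt (a c z : R) : (a <= z <= c) \/ (c <= z <= a) -> `|z| <= `|a| + `|c|.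
  have := ler_norm a; have := ler_norm c; have := ler_norm (- a).
  have := ler_norm (- c); rewrite !normrN ler_norml => ? ? ? ? h.
  by apply/andP; split; case: h => /andP[]; lra.
rewrite /b -addrA.
case: xi => [|[z zi <-]].
  rewrite /sys_dom/= in_itv/= => h; rewrite ler_wpDr ?addr_ge0//.
  by apply: bt; left.
rewrite ler_wpDl ?addr_ge0//; apply: bt.
have lohi := sys_lt S i.
have lo : sys_lo S i \in `[sys_lo S i, sys_hi S i] by rewrite in_itv/= lexx ltW.
have hi : sys_hi S i \in `[sys_lo S i, sys_hi S i] by rewrite in_itv/= lexx ltW.
have /andP[] : sys_lo S i <= z <= sys_hi S i by move: zi; rewrite /sys_dom/= in_itv.
rewrite !le_eqVlt => /predU1P[<-|lz] /predU1P[zh|zh]; case: (sys_mono S i) => g;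
  try rewrite zh in zi *; rewrite ?eqxx/=;
  do ?[by left; rewrite ?g ?orbT//| by right; rewrite ?g ?orbT//].
Qed.

(** * Finite words and initial segments of sequences *)

Definition full_words (R : realType) (n : nat) (S : system R n) (k : nat) :=
  [set w : k.-tuple 'I_n | `[< (word_dom S (map Some w))° !=set0 >]]%SET.

Definition pad_word (n N k : nat) (v : k.-tuple 'I_n) :
  {ffun 'I_N -> option 'I_n} := [ffun i : 'I_N => nth None (map Some v) i].

Definition padded_words (R : realType) (n : nat) (S : system R n) (N : nat) :=
  (\bigcup_(k < N.+1) [set pad_word N v | v in full_words S k])%SET.

Lemma card_padded_words (R : realType) (n : nat) (S : system R n) (N : nat) :
  (#|padded_words S N| <= \sum_(k < N.+1) ell S k)%N.
Proof.
rewrite /padded_words; elim/big_ind2: _ => [|A a B b Aa Bb|k _].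
- by rewrite cards0.
- by apply: leq_trans (leq_add Aa Bb); rewrite cardsU leq_subr.
- exact: leq_imset_card.
Qed.

(** The leading non-empty symbols form a word whose domain has nonempty interior by admissibility;
    the rest is padding. *)
Lemma Gamma_padded_words (R : realType) (n : nat) (hn : (0 < n)%N)
    (S : system R n) (N : nat) (p : (nat -> option 'I_n) * R) :
  Gamma S p -> [ffun i : 'I_N => p.1 i] \in padded_words S N.
Proof.
case: p => w x [/= Sw _ adm].
(* [k] counts the non-empty symbols among the first [N], which treats both kinds of sequences of
   [Sigma] at once. *)
have [k [kN wlt wge]] : exists k, [/\ (k <= N)%N,
    forall m, (m < k)%N -> w m <> None &
    forall m, (k <= m < N)%N -> w m = None].
  case: Sw => [wN|[k [wlt wge]]].
    by exists N; split=> // m; case: ltngtP.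
  exists (minn k N); split; first exact: geq_minr.
    by move=> m; rewrite leq_min => /andP[mk _]; exact: wlt.
  by move=> m; rewrite geq_min => /andP[/orP[/wge//|+ mN]]; rewrite leqNgt mN.
pose i0 : 'I_n := Ordinal hn.
pose v := [tuple odflt i0 (w i) | i < k].
have vw i : (i < k)%N -> nth None (map Some v) i = w i.
  move=> ik; rewrite (nth_map i0) ?size_tuple//.
  rewrite -[i]/(val (Ordinal ik)) -tnth_nth tnth_mktuple /=.
  by have := wlt i ik; case: (w i).
have mv : map Some v = mkseq w k.
  apply: (@eq_from_nth _ None); first by rewrite size_map size_tuple size_mkseq.
  move=> i; rewrite size_map size_tuple => ik.
  by rewrite vw// nth_mkseq.
apply/bigcupP; exists (Ordinal (kN : (k < N.+1)%N)) => //=.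
apply/imsetP; exists v.
  rewrite inE; apply/asboolP; rewrite mv.
  (* Admissibility speaks of positive lengths only; the empty word has the whole line as domain. *)
  case: (posnP k) => [->|k0]; last by have [] := adm k k0.
  by rewrite /= interiorT; exists 0.
apply/ffunP => i; rewrite !ffunE.
have [ik|ki] := ltnP i k; first by rewrite vw.
by rewrite nth_default ?mv ?size_mkseq// wge// ki ltn_ord.
Qed.

(** * Lower bound: orbits separated by their symbols *)

Lemma word_dom_nseq_None (R : realType) (n : nat) (S : system R n) (k : nat) :
  word_dom S (nseq k None) = setT.
Proof. by elim: k => //= k ->; rewrite setTI preimage_setT. Qed.

(** The constant empty sequence is admissible for every point; an endpoint of some domain lies in
    [Ihat]. *)
Lemma Gamma_inhabited (R : realType) (n : nat) (hn : (0 < n)%N)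
    (S : system R n) : inhabited (Gamma S).
Proof.
suff pG : Gamma S (fun=> None, sys_lo S (Ordinal hn)).
  exact: (inhabits (SigSub (mem_set pG))).
split=> /=.
- by right; exists 0%N.
- exists (Ordinal hn) => //; left.
  by rewrite /sys_dom /= in_itv/= lexx ltW// sys_lt.
- move=> k _; have -> : mkseq (fun=> None) k = nseq k None :> seq (option 'I_n).
    apply: (@eq_from_nth _ None) => [|i]; rewrite size_mkseq ?size_nseq// => ik.
    by rewrite nth_mkseq// nth_nseq if_same.
  by rewrite word_dom_nseq_None interiorT; split=> //; exists 0.
Qed.

(** If two words differ at letter [j], then after [j] shifts the sequences differ at their first
    symbol, which already costs 1/2. The base point over each word can be any point interior to its
    domain. *)
Lemma ell_le_sep_card (R : realType) (n : nat) (hn : (0 < n)%N)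
    (S : system R n) (m : nat) (e : R) : (0 < m)%N -> e < 2^-1 ->
  ((ell S m)%:R%:E <= sep_card (@Gamma_dist R n S) (@skew_product R n S) m e)%E.
Proof.
move=> m0 e2; apply: ereal_sup_ubound; exists (ell S m) => //.
pose w (u : m.-tuple 'I_n) := fun i => nth None (map Some u) i.
have pt (u : m.-tuple 'I_n) : u \in full_words S m ->
    exists p : Gamma S, (val p).1 = w u.
  rewrite inE => /asboolP [x ux].
  (* Truncated subtraction makes the padding empty when [k <= m]. *)
  have mk k : mkseq (w u) k = map Some (take k u) ++ nseq (k - m) None.
    apply: (@eq_from_nth _ None).
      rewrite size_mkseq size_cat size_map size_take size_tuple size_nseq.
      by case: ltnP => [/ltnW/subnKC|]; lia.
    move=> i; rewrite size_mkseq => ik; rewrite nth_mkseq// nth_cat size_map.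
    rewrite size_take size_tuple map_take nth_take// nth_nseq.
    case: ifP => // h; rewrite /w nth_default ?size_map ?size_tuple ?if_same//.
    by move: h; case: (ltnP k m) => _; lia.
  have dcat a b : word_dom S (map Some (a ++ b)) `<=` word_dom S (map Some a).
    by elim: a => [|i a IH] //= z [zi /IH].
  have dcatn a l : word_dom S (map Some a ++ nseq l None) = word_dom S (map Some a).
    by elim: a => [|i a /= ->//]; exact: word_dom_nseq_None.
  have sub k : word_dom S (map Some u) `<=` word_dom S (mkseq (w u) k).
    by rewrite mk dcatn -{1}(cat_take_drop k u); exact: dcat.
  have xu := interior_subset ux.
  have pG : Gamma S (w u, x).
    split=> /=.
    - right; exists m; split=> k km; rewrite /w.
        by rewrite (nth_map (Ordinal hn)) ?size_tuple.
      by rewrite nth_default// size_map size_tuple.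
    (* As [0 < m], there is a first letter, and its domain puts the base point in [Ihat]. *)
    - case: m m0 u {w dcat dcatn mk sub} ux xu => // m' _ u ux.
      by case: (tupleP u) => i u' [xi _]; exists i => //; left.
    - move=> k k1; split; last exact: sub.
      by exists x; exact: (interiorS (@sub k)).
  by exists (SigSub (mem_set pG)).
have [p0] := Gamma_inhabited hn S.
have /choice[g gP] : forall u : m.-tuple 'I_n, exists p : Gamma S,
    u \in full_words S m -> (val p).1 = w u.
  move=> u; have [/pt[p pu]|] := boolP (u \in full_words S m); first by exists p.
  by exists p0.
pose u0 : m.-tuple 'I_n := [tuple Ordinal hn | i < m].
pose h k := nth u0 (enum (full_words S m)) k.
have hin k : (k < ell S m)%N -> h k \in full_words S m.
  by move=> k1; rewrite -mem_enum mem_nth// -cardE.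
have winj (u v : m.-tuple 'I_n) : (forall j : 'I_m, w u j = w v j) -> u = v.
  move=> uv; apply/eq_from_tnth => j; have := uv j.
  rewrite /w !(nth_map (Ordinal hn)) ?size_tuple//.
  by rewrite !(tnth_nth (Ordinal hn)) => -[].
have gsep u v : u \in full_words S m -> v \in full_words S m -> u <> v ->
    e < orbit_dist (@Gamma_dist R n S) (@skew_product R n S) m (g u) (g v).
  move=> uA vA uv.
  have [j wj] : exists j : 'I_m, w u j != w v j.
    by apply: contrapT => /forallNP h1; apply: uv; apply: winj => j; apply/eqP;
       apply: contrapT => /negP /h1.
  apply: (lt_le_trans e2); apply: le_trans (le_bigmax _ _ j).
  rewrite /Gamma_dist le_max symb_dist_head_neq//.
  by rewrite !val_iter_skew_product !iter_skew_fun_symb !gP.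
(* The symbols of [g u] spell [u], so [g] is injective on [full_words]. *)
have gin : {in `I_(ell S m) &, injective (g \o h)}.
  move=> k l; rewrite !inE /= => kA lA gkl.
  have : h k = h l.
    by apply: winj => j; rewrite -!gP ?hin// [g (h k)]gkl.
  by move=> /eqP; rewrite nth_uniq ?enum_uniq -?cardE// => /eqP.
exists ((g \o h) @` `I_(ell S m)); split; first exact: inj_card_eq.
move=> _ _ [k kA <-] [l lA <-] kl; apply: gsep; try exact: hin.
by move=> hkl; apply: kl; rewrite /= hkl.
Qed.

(** * Upper bound: coding orbits by words and cells *)

Definition signed_orbit_sum (R : realType) (n : nat) (S : system R n) (m : nat)
    (p : Gamma S) : R :=
  \sum_(j < m) word_sgn S (val p).1 j * (iter j (skew_fun S) (val p)).2.

(** Over a common word the signed differences of iterates all have the same sign, so nothing cancels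
    in the difference of the sums and it dominates each term. *)
Lemma dist_le_signed_orbit_sum (R : realType) (n : nat) (S : system R n)
    (m : nat) (p q : Gamma S) (j : 'I_m) :
  (forall i, (i < m)%N -> (val p).1 i = (val q).1 i) ->
  `|(iter j (skew_fun S) (val p)).2 - (iter j (skew_fun S) (val q)).2| <=
  `|signed_orbit_sum m p - signed_orbit_sum m q|.
Proof.
wlog pq : p q / (val p).2 <= (val q).2.
  move=> H; case: (leP (val p).2 (val q).2) => [/H//|/ltW qp epq].
  by rewrite distrC [X in _ <= X]distrC; apply: H => // i /epq.
move=> epq.
pose d (i : 'I_m) := word_sgn S (val p).1 i *
  ((iter i (skew_fun S) (val q)).2 - (iter i (skew_fun S) (val p)).2).
have d0 i : 0 <= d i.
  by apply: word_sgnP => // k ki; apply: epq; exact: ltn_trans (ltn_ord i).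
have -> : signed_orbit_sum m p - signed_orbit_sum m q = - \sum_i d i.
  rewrite -sumrB -sumrN; apply: eq_bigr => i _.
  have -> : word_sgn S (val q).1 i = word_sgn S (val p).1 i.
    apply: eq_bigr => l _; rewrite epq//.
    exact: ltn_trans (ltn_ord i).
  by rewrite -mulrBr -mulrN opprB.
rewrite normrN (ger0_norm (sumr_ge0 _ _))// distrC.
rewrite -[X in X <= _]mul1r -(word_sgn_norm S (val p).1 j) -normrM -/(d j).
by rewrite ger0_norm// (bigD1 j)//= lerDl sumr_ge0.
Qed.

(** Pigeonhole: points with the same word of length [m + r] and signed sums in the same cell of
    width [e] stay [e]-close for [m] steps, so a separated set injects into the codes. *)
Lemma sep_card_le (R : realType) (n : nat) (hn : (0 < n)%N) (S : system R n)
    (M : R) (HM : forall x, Ihat S x -> `|x| <= M) (m r : nat) (e : R) :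
  0 < e -> (2^-1) ^+ r <= e -> 0 <= M ->
  (sep_card (@Gamma_dist R n S) (@skew_product R n S) m e <=
   ((\sum_(k < (m + r).+1) ell S k)%:R * (2 * m%:R * M / e + 1))%:E)%E.
Proof.
move=> e0 re M0.
pose Z := m%:R * M.
have Phi (p : Gamma S) : 0 <= (signed_orbit_sum m p + Z) / e <= 2 * m%:R * M / e.
  have : `|signed_orbit_sum m p| <= Z.
    apply: le_trans (ler_norm_sum _ _ _) _.
    have -> : Z = \sum_(j < m) M by rewrite /Z sumr_const card_ord mulr_natl.
    apply: ler_sum => j _; rewrite normrM word_sgn_norm mul1r; apply: HM.
    by have [] := Gamma_iter j p.
  rewrite ler_norml => /andP[h1 h2].
  rewrite divr_ge0 ?(ltW e0)//=; last by lra.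
  by rewrite ler_pM2r ?invr_gt0// -mulrA -/Z; lra.
(* The rescaled sum lies between 0 and [2 * m * M / e], so its integer part takes at most [K + 1]
   values. *)
pose K := Num.truncn (2 * m%:R * M / e).
pose cell (p : Gamma S) : 'I_K.+1 := inord (Num.truncn ((signed_orbit_sum m p + Z) / e)).
have cellE p : nat_of_ord (cell p) = Num.truncn ((signed_orbit_sum m p + Z) / e).
  rewrite inordK// ltnS; apply: le_truncn.
  by have /andP[] := Phi p.
pose code (p : Gamma S) := ([ffun i : 'I_(m + r) => (val p).1 i], cell p).
have codeP p q : code p = code q ->
    orbit_dist (@Gamma_dist R n S) (@skew_product R n S) m p q <= e.
  case=> /ffunP pq /(congr1 val)/=; rewrite !cellE => cpq.
  have epq i : (i < m + r)%N -> (val p).1 i = (val q).1 i.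
    by move=> ik; have := pq (Ordinal ik); rewrite !ffunE.
  have PP : `|signed_orbit_sum m p - signed_orbit_sum m q| <= e.
    have /andP[p0 _] := Phi p; have /andP[q0 _] := Phi q.
    have /andP[] := truncn_itv p0; have /andP[] := truncn_itv q0.
    rewrite cpq; set t := Num.truncn _.
    rewrite -addn1 natrD !ler_pdivlMr// !ltr_pdivrMr// mulrDl mul1r => *.
    by rewrite ler_norml; apply/andP; split; lra.
  apply: bigmax_le; first exact: ltW.
  move=> j _; rewrite /Gamma_dist !val_iter_skew_product ge_max; apply/andP; split.
    (* After [j < m] shifts at least [r] of the [m + r] common symbols are left. *)
    apply: le_trans re; apply: symb_dist_prefix => i ir.
    rewrite !iter_skew_fun_symb; apply: epq.
    by have := ltn_ord j; lia.
  apply: le_trans PP; apply: dist_le_signed_orbit_sum => i im.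
  by apply: epq; rewrite ltn_addr.
apply: ge_ereal_sup => _ [N [E [EN Esep]] <-]; rewrite lee_fin.
move: EN; rewrite card_eq_sym card_eq_le => /andP[/card_leP[f] _].
pose g (k : 'I_N) : E := f (SigSub (mem_set (ltn_ord k : `I_N k))).
have gE k : E (val (g k)) by exact: (set_mem (valP _)).
pose D := finset.setX (padded_words S (m + r)) [set: 'I_K.+1]%SET.
pose c (k : 'I_N) := code (val (g k)).
have cinj : injective c.
  move=> k l /codeP kl; apply: contrapT => nkl.
  have gkl : val (g k) <> val (g l).
    move=> /val_inj h; apply: nkl; apply: val_inj.
    have fkl := @inj _ _ _ f _ _ (mem_setT _) (mem_setT _) h.
    exact: (congr1 val fkl).
  by have := Esep _ _ (gE k) (gE l) gkl; rewrite ltNge kl.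
have ND : (N <= #|D|)%N.
  rewrite -[N]card_ord -(card_imset _ cinj); apply: subset_leq_card.
  apply/fintype.subsetP => _ /imsetP[k _ ->].
  rewrite inE /= inE andbT; apply: Gamma_padded_words => //.
  exact: (set_mem (valP _)).
rewrite cardsX cardsT card_ord in ND.
apply: (@le_trans _ _ (((\sum_(k < (m + r).+1) ell S k) * K.+1)%:R)).
  by rewrite ler_nat (leq_trans ND)// leq_mul2r card_padded_words orbT.
rewrite natrM ler_wpM2l// -addn1 natrD lerD2r.
by rewrite truncn_le// divr_ge0 ?mulr_ge0// ltW.
Qed.

(** * Limits superior and growth rates *)

Lemma le_limn_esup (R : realType) (u v : (\bar R)^nat) :
  (forall m, (u m <= v m)%E) -> (limn_esup u <= limn_esup v)%E.
Proof.
move=> uv; apply: le_ereal_inf_tmp => _ [V VF <-].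
apply: (@le_trans _ _ (ereal_sup [set u x | x in V])).
  by apply: ereal_inf_lbound; exists V.
apply: ge_ereal_sup => _ [x Vx <-]; apply: le_trans (uv x) _.
by apply: ereal_sup_ubound; exists x.
Qed.

Lemma limn_esup_le (R : realType) (u : (\bar R)^nat) (c : \bar R) (N : nat) :
  (forall m, (N <= m)%N -> (u m <= c)%E) -> (limn_esup u <= c)%E.
Proof.
move=> uc; apply: (@le_trans _ _ (ereal_sup [set u x | x in [set m | (N <= m)%N]])).
  by apply: ereal_inf_lbound; exists [set m | (N <= m)%N] => //; exact: nbhs_infty_ge.
by apply: ge_ereal_sup => _ [x Nx <-]; exact: uc.
Qed.

Lemma limn_esup_lt (R : realType) (u : (\bar R)^nat) (c : \bar R) :
  (limn_esup u < c)%E ->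
  exists N, forall m, (N <= m)%N -> (u m <= c)%E.
Proof.
move=> /ereal_inf_lt[_ [V [N _ NV] <-] Vc]; exists N => m Nm.
apply: le_trans (ltW Vc); apply: ereal_sup_ubound.
by exists m => //; exact: NV.
Qed.

Lemma htop_system_ge0 (R : realType) (n : nat) (S : system R n) :
  (0 <= htop_system S)%E.
Proof.
apply: limf_esup_ge0 => [|m].
  by case=> N _ /(_ N); apply => /=.
rewrite lee_fin mulr_ge0//.
(* [ln] vanishes at 0, so the terms with [ell S m = 0] are nonnegative too. *)
by case: (ell S m) => [|k]; [rewrite ln0|rewrite ln_ge0 ?ler1n].
Qed.

(** Turns a strict bound on the limit superior into one valid for every length, as needed to sum
    over all [k <= m + r]. *)
Lemma ell_growth (R : realType) (n : nat) (S : system R n) (c : R) :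
  (htop_system S < c%:E)%E ->
  exists2 C : R, 0 <= C & forall k, (ell S k)%:R <= C * expR (c * k%:R).
Proof.
move=> hc; have c0 : 0 < c by rewrite -lte_fin (le_lt_trans (htop_system_ge0 S)).
have [N HN] := limn_esup_lt hc.
pose C0 : R := \sum_(k < N.+1) (ell S k)%:R.
have C00 : 0 <= C0 by rewrite sumr_ge0.
(* [C0] covers the lengths up to [N], and 1 the later ones. *)
exists (1 + C0); first by rewrite addr_ge0.
move=> k; have e1 : 1 <= expR (c * k%:R).
  by rewrite -expR0 ler_expR mulr_ge0// ltW.
have [kN|Nk] := ltnP k N.+1.
  have : (ell S k)%:R <= C0.
    by rewrite /C0 (bigD1 (Ordinal kN))//= lerDl sumr_ge0.
  by move=> h; rewrite -[X in X <= _]mulr1 ler_pM//; lra.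
have h := HN k (ltnW Nk).
apply: (@le_trans _ _ (expR (c * k%:R))); last by rewrite ler_peMl ?expR_ge0//; lra.
have k0 : (0 : R) < k%:R by rewrite ltr0n (leq_ltn_trans _ Nk).
have [->|e0] := posnP (ell S k); first exact: expR_ge0.
rewrite -[X in X <= _]lnK ?posrE ?ltr0n// ler_expR.
by move: h; rewrite lee_fin ler_pdivrMl// mulrC.
Qed.

(** The cubic term of the exponential series suffices: [D * m^2 <= (d * m)^3 / 6] once
    [m >= 6 * D / d^3]. The square to be absorbed has one factor [m] from the number of word lengths
    and one from the number of cells. *)
Lemma square_le_expR (R : realType) (D d : R) : 0 <= D -> 0 < d ->
  exists N, forall m, (N <= m)%N -> D * m%:R ^+ 2 <= expR (d * m%:R).
Proof.
move=> D0 d0; exists (Num.truncn (6 * D / d ^+ 3)).+1 => m Nm.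
have d3 : 0 < d ^+ 3 by rewrite exprn_gt0.
have : 6 * D / d ^+ 3 < m%:R.
  by apply: lt_le_trans (truncnS_gt _) _; rewrite ler_nat.
rewrite ltr_pdivrMr// => h.
have dm0 : 0 <= d * m%:R by rewrite mulr_ge0// ltW.
apply: le_trans (expR_ge1Dxn 2 dm0); rewrite exprMn.
have -> : (3`!)%:R = 6 :> R by [].
rewrite [m%:R ^+ 3]exprS.
have := ler_wpM2r (sqr_ge0 m%:R) (ltW h).
lra.
Qed.

Lemma sep_card_ge1 (R : realType) (n : nat) (hn : (0 < n)%N) (S : system R n)
    (m : nat) (e : R) :
  (1 <= sep_card (@Gamma_dist R n S) (@skew_product R n S) m e)%E.
Proof.
have [p] := Gamma_inhabited hn S.
apply: ereal_sup_ubound; exists 1%N => //; exists [set p]; split.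
  exact: card_set1.
by move=> x y -> ->.
Qed.

Lemma sep_card_eventually_le (R : realType) (n : nat) (hn : (0 < n)%N)
    (S : system R n) (e c d : R) :
  0 < e -> 0 < d -> (htop_system S < c%:E)%E -> exists N, forall m, (N <= m)%N ->
  (sep_card (@Gamma_dist R n S) (@skew_product R n S) m e
    <= (expR ((c + d) * m%:R))%:E)%E.
Proof.
move=> e0 d0 hc; have c0 : 0 < c.
  by rewrite -lte_fin (le_lt_trans (htop_system_ge0 S)).
have [C C0 HC] := ell_growth hc; have [M M0 HM] := Ihat_bounded S.
have [r re] : exists r, (2^-1) ^+ r <= e.
  have : (fun r => (2^-1 : R) ^+ r) @ \oo --> 0.
    by apply: cvg_expr; rewrite gtr0_norm ?invf_lt1// ltr1n.
  move=> /cvgr0_norm_le/(_ e e0)[r _ H]; exists r.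
  by have := H r (leqnn r); rewrite ger0_norm.
have L0 : 0 <= 2 * M / e by rewrite divr_ge0 ?mulr_ge0// ltW.
(* For [m >= 1], [D] collects the constants of [m + r + 1 <= m * (r + 2)],
   [ell S k <= C * expR (c * (r + m))] and [2 * m * M / e + 1 <= (2 * M / e + 1) * m]. *)
pose D := (r.+2%:R * C * expR (c * r%:R)) * (2 * M / e + 1).
have D0 : 0 <= D.
  by rewrite !mulr_ge0 ?expR_ge0// addr_ge0.
have [N HN] := square_le_expR D0 d0.
exists N.+1 => m Nm; apply: le_trans (sep_card_le hn HM m e0 re (ltW M0)) _.
rewrite lee_fin [(c + d) * _]mulrDl expRD.
have m1 : (1 : R) <= m%:R by rewrite ler1n (leq_ltn_trans _ Nm).
apply: (@le_trans _ _ (D * m%:R ^+ 2 * expR (c * m%:R))); last first.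
  by rewrite mulrC ler_wpM2l ?expR_ge0// HN// ltnW.
have -> : D * m%:R ^+ 2 * expR (c * m%:R) =
  ((m%:R * r.+2%:R) * (C * (expR (c * r%:R) * expR (c * m%:R)))) *
  ((2 * M / e + 1) * m%:R) by rewrite /D; ring.
apply: ler_pM => //.
- by rewrite addr_ge0// divr_ge0 ?mulr_ge0// ltW.
- rewrite natr_sum -expRD -mulrDr -natrD.
  apply: (@le_trans _ _ (\sum_(k < (m + r).+1) C * expR (c * (r + m)%:R))).
    apply: ler_sum => k _; apply: le_trans (HC k) _.
    rewrite ler_wpM2l// ler_expR ler_wpM2l ?(ltW c0)// ler_nat.
    by have := ltn_ord k; lia.
  rewrite sumr_const card_ord -[X in X <= _]mulr_natl ler_wpM2r ?mulr_ge0 ?expR_ge0//.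
  by rewrite -natrM ler_nat; nia.
- have -> : 2 * m%:R * M / e = (2 * M / e) * m%:R by ring.
  by rewrite [(_ + 1) * m%:R]mulrDl mul1r lerD2l.
Qed.

(** * Entropy at a fixed scale and its limit *)

(** The two counting bounds meet at every scale below 1/2, so the growth rate is already independent
    of [e] there. *)
Lemma limn_esup_sep_card (R : realType) (n : nat) (hn : (0 < n)%N)
    (S : system R n) (e : R) : 0 < e -> e < 2^-1 ->
  limn_esup (fun m : nat => (m%:R^-1)%:E *
    lne (sep_card (@Gamma_dist R n S) (@skew_product R n S) m e))%E = htop_system S.
Proof.
move=> e0 e2; have sep1 m := sep_card_ge1 hn S m e.
have sep_ge0 m : sep_card (@Gamma_dist R n S) (@skew_product R n S) m e \in `[0%E, +oo%E].
  by rewrite in_itv/= leey andbT (le_trans _ (sep1 m)).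
apply/eqP; rewrite eq_le; apply/andP; split; last first.
  (* At [m = 0] both terms are 0, since the inverse of 0 is 0. *)
  apply: le_limn_esup => -[|m]; first by rewrite invr0 mul0r mul0e.
  rewrite EFinM lee_wpmul2l ?lee_fin ?invr_ge0//.
  (* [ln] and [lne] are matched at positive arguments only; when [ell] vanishes, the left side is 0
     and [sep_card >= 1] suffices. *)
  have [->|l0] := posnP (ell S m.+1); first by rewrite ln0// lne_ge0.
  rewrite -lne_EFin ?ltr0n// lee_lne//; last by rewrite in_itv/= leey andbT lee_fin.
  exact: ell_le_sep_card.
have := htop_system_ge0 S; case h : (htop_system S) => [h0| |]//; last first.
  by move=> _; rewrite leey.
move=> h00; apply/lee_addgt0Pr => d d0.
(* Half of [d] gives a rate strictly above the entropy; the other half absorbs the polynomial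
   factor. *)
have hc : (htop_system S < (h0 + d / 2)%:E)%E.
  by rewrite h lte_fin ltrDl divr_gt0.
have [N HN] := sep_card_eventually_le hn e0 (divr_gt0 d0 (ltr0n R 2)) hc.
apply: (@limn_esup_le _ _ _ N.+1) => m Nm.
have m0 : (0 : R) < m%:R by rewrite ltr0n (leq_ltn_trans _ Nm).
have := HN m (ltnW Nm); rewrite -lee_lne//; last first.
  by rewrite in_itv/= leey andbT lee_fin expR_ge0.
rewrite lne_EFin ?expR_gt0// expRK -addrA -splitr => H.
apply: (@le_trans _ _ ((m%:R^-1)%:E * ((h0 + d) * m%:R)%:E)%E).
  by rewrite lee_wpmul2l// lee_fin invr_ge0.
by rewrite -EFinM -EFinD mulrC mulfK ?gt_eqF.
Qed.

Theorem theorem5p3 (R : realType) (n : nat) (hn : (0 < n)%N)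
  (S : system R n) :
  bowen_entropy (@Gamma_dist R n S) (@skew_product R n S) = htop_system S.
Proof.
(* The limit superior is constant for [e] between 0 and 1/2, so its limit at 0 from the right is
   that constant. *)
apply: lim_near_cst; first exact: ereal_hausdorff.
by near=> e; apply: limn_esup_sep_card => //; near: e; exact: nbhs_right_lt.
Unshelve. all: by end_near. Qed.
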